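(* There exists a universal constant $c>0$ such that for all integers $q\ge 2$, $n\ge 1$ and $1\le t\le n$ there exists a nonempty orthogonal array $T\subset\{1,\ldots,q\}^n$ of alphabet size $q$, length $n$ and strength $t$ satisfying $$|T|\le \left(\frac{cqn}{t}\right)^{ct}.$$
   Context: Write $[m]:=\{1,\ldots,m\}$. A subset $T\subset[q]^n$ is an orthogonal array of alphabet size $q$, length $n$ and strength $t$ if for any distinct indices $i_1,\ldots,i_t\in[n]$ and any (not necessarily distinct) values $v_1,\ldots,v_t\in[q]$, $$\left|\{x\in T:\ x_{i_1}=v_1,\ldots,x_{i_t}=v_t\}\right| = q^{-t}|T|.$$ A universal constant is one independent of all other parameters. *)

(* Defs.v *)
From mathcomp Require Import all_boot all_order all_algebra.

Set Implicit Arguments.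
Unset Strict Implicit.
Unset Printing Implicit Defensive.

Import Order.TTheory GRing.Theory Num.Theory.

Local Open Scope ring_scope.

(* Alphabet, coordinates and index positions are numbered from 0 instead of 1:
   [q] is 'I_q, [n] is 'I_n, and a choice of t distinct indices is an injective
   map 'I_t -> 'I_n. *)
Definition orthogonal_array (q n t : nat) (T : {set {ffun 'I_n -> 'I_q}}) : Prop :=
  forall (i : 'I_t -> 'I_n) (v : 'I_t -> 'I_q), injective i ->
    #|[set x in T | [forall j, x (i j) == v j]]|%:R
      = (q%:R ^+ t)^-1 * #|T|%:R :> rat.

(* Main.v *)
Require Import Defs.
From mathcomp Require Import all_boot all_order all_algebra all_field.
From mathcomp Require Import reals exp.
From mathcomp Require Import zify.

(* Let K be a field with 2^e >= (q n / t)^O(1) elements.  By Gilbert-Varshamov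
   some linear map on K^n has fibres that are orthogonal arrays of strength t and
   of size |K|^(2t).  Send K to [q] with all classes of equal size, except that
   |K| mod q elements become blanks.  Counting gives a fibre all of whose words have
   fewer than 4t blanks; filling the blanks with independent uniform symbols gives a
   t-wise uniform multiset of words over [q], of size |K|^(2t) q^(4t).

   To remove repetitions, only n - m coordinates are treated in this way, with
   m = O(t log(q n / t) / log q).  On the other m coordinates, [q]^m is partitioned
   into q^(m/2) orthogonal arrays of equal size (cosets of linear codes over F_p,
   multiplied over the primes p dividing q), and each word of the multiset is
   extended by all the words of its own part.  If n is too small for this, all
   of [q]^n is small enough. *)

Set Implicit Arguments.
Unset Strict Implicit.
Unset Printing Implicit Defensive.

Import Order.TTheory GRing.Theory Num.Theory.

Local Open Scope ring_scope.

(** * Counting in finite types, and Gilbert-Varshamov matrices *)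

Lemma leq_card_bigcup (I T : finType) (P : pred I) (B : I -> {set T}) :
  (#|\bigcup_(i | P i) B i| <= \sum_(i | P i) #|B i|)%N.
Proof.
elim/big_rec2: _ => [|i m U _ IH]; first by rewrite cards0.
by rewrite (leq_trans (leq_card_setU _ _)) // leq_add2l.
Qed.

Lemma card_ffun_prod (I A : finType) (B : I -> pred A) :
  #|[set x : {ffun I -> A} | [forall i, B i (x i)]]| = (\prod_i #|B i|)%N.
Proof.
rewrite cardsE -(eq_card (A := family B)); last by move=> x; rewrite !inE.
by rewrite card_family foldrE big_map big_enum.
Qed.

Lemma prod_nat_if (I : finType) (S : {set I}) (a b : nat) :
  (\prod_(i in I) (if i \in S then a else b) = a ^ #|S| * b ^ (#|I| - #|S|))%N.
Proof.
rewrite (bigID (mem S)) /=; congr (_ * _)%N.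
  by rewrite -prod_nat_const; apply: eq_bigr => i ->.
have -> : (#|I| - #|S|)%N = #|~: S| by rewrite [RHS]cardsCs setCK.
rewrite -prod_nat_const.
by apply: eq_big => [i|i /negbTE->] //; rewrite inE.
Qed.

Lemma exists_subset_card (T : finType) (S : {set T}) k :
  (#|S| <= k <= #|T|)%N -> exists2 S' : {set T}, S \subset S' & #|S'| = k.
Proof.
case/andP=> Sk kT; move: Sk; elim: k kT => [|k IH] kT.
  by rewrite leqn0 => /eqP S0; exists S.
rewrite leq_eqVlt => /orP[/eqP eS|]; first by exists S.
rewrite ltnS => /(IH (ltnW kT))[S' sS eS'].
have /set0Pn[x] : ~: S' != set0.
  by rewrite -card_gt0 cardsCs setCK eS' subn_gt0.
rewrite inE => xS; exists (x |: S'); last by rewrite cardsU1 xS eS'.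
by rewrite (subset_trans sS) ?subsetUr.
Qed.

(* Gilbert-Varshamov: the rows are chosen greedily, each new one avoiding the
   translates of the Hamming ball of radius t by the span of the previous ones. *)
Lemma gilbert_varshamov (F : finFieldType) (n t r : nat) : (t <= n)%N ->
  ('C(n, t) * #|F| ^ t * #|F| ^ r.-1 < #|F| ^ n)%N ->
  exists A : 'M[F]_(r, n), forall y : 'rV_r, y != 0 ->
    forall S : {set 'I_n}, (#|S| <= t)%N ->
    exists2 j, j \notin S & (y *m A) 0 j != 0.
Proof.
move=> tn; elim: r => [|r IH] hr.
  by exists 0 => y; rewrite thinmx0 eqxx.
have F1 : (1 < #|F|)%N by apply: finNzRing_gt1.
have [|A hA] := IH.
  by apply: leq_ltn_trans hr; rewrite leq_mul2l (leq_pexp2l (ltnW F1)) ?orbT ?leq_pred.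
(* These are the words equal to [b] outside [S]; the Hamming ball around [b] is their union over
   [#|S| = t]. *)
pose ball (b : 'rV[F]_n) (S : {set 'I_n}) :=
  [set a : 'rV[F]_n | [forall j, (j \notin S) ==> (a 0 j == b 0 j)]].
have ball_card b S : (#|ball b S| <= #|F| ^ #|S|)%N.
  pose f (a : 'rV[F]_n) := [ffun j => a 0 j].
  have finj : injective f.
    by move=> a a' /ffunP e; apply/rowP => j; move: (e j); rewrite !ffunE.
  rewrite -(card_imset _ finj).
  pose B j : pred F := if j \in S then predT else pred1 (b 0 j).
  apply: (@leq_trans #|[set x : {ffun 'I_n -> F} | [forall j, B j (x j)]]|).
    apply/subset_leq_card/subsetP => x /imsetP[a].
    rewrite /ball inE => /forallP ha ->.
    rewrite inE; apply/forallP => j; rewrite /B ffunE.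
    by case: ifP (ha j) => // ->.
  rewrite card_ffun_prod (eq_bigr (fun i => if i \in S then #|F| else 1%N)).
    by rewrite prod_nat_if exp1n muln1.
  by move=> j _; rewrite /B; case: ifP => _; rewrite ?card1.
pose Bad := \bigcup_(y : 'rV[F]_r) \bigcup_(S : {set 'I_n} | #|S| == t) ball (y *m A) S.
(* Union bound over the [#|F| ^ r] combinations of the [r] earlier rows; in [hr], [r.+1.-1] is
   [r]. *)
have : (#|Bad| < #|[set: 'rV[F]_n]|)%N.
  rewrite cardsT card_mx mul1n; apply: leq_ltn_trans hr => /=.
  apply: leq_trans (leq_card_bigcup _ _) _.
  apply: (@leq_trans (\sum_(y : 'rV[F]_r) 'C(n, t) * #|F| ^ t)%N); last first.
    by rewrite sum_nat_const card_mx mul1n mulnC.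
  apply: leq_sum => y _; apply: leq_trans (leq_card_bigcup _ _) _.
  rewrite -[n in 'C(n, _)]card_ord -cardsT -cards_draws -sum_nat_const.
  rewrite [X in (_ <= X)%N](eq_bigl (fun S : {set 'I_n} => #|S| == t)).
    by apply: leq_sum => S /eqP <-.
  by move=> S; rewrite !inE subsetT.
move=> ltBad; have /subsetPn[a _ aBad] : ~~ ([set: 'rV[F]_n] \subset Bad).
  by apply: contraL ltBad => /subset_leq_card; rewrite leqNgt.
exists (col_mx a A) => y y0 S St.
rewrite -[r.+1]/(1 + r)%N in y y0 *.
rewrite -(hsubmxK y) mul_row_col.
set y1 := lsubmx y; set y2 := rsubmx y.
have -> : y1 *m a = (y1 0 0) *: a by rewrite {1}(mx11_scalar y1) mul_scalar_mx.
have [y10|y10] := eqVneq (y1 0 0) 0.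
  rewrite y10 scale0r add0r; apply: hA => //.
  apply: contraNneq y0 => y20; rewrite -(hsubmxK y) -/y1 -/y2 y20.
  by rewrite (mx11_scalar y1) y10 raddf0 row_mx0.
(* [Bad] involves sets of size exactly [t], so [S] is enlarged. If the combination vanished outside
   [S'], dividing by the coefficient of [a] would put [a] in [Bad]. *)
have [|S' sS eS'] := @exists_subset_card _ S t; first by rewrite St card_ord.
have /existsP[j] : [exists j, (j \notin S') && (a 0 j != ((- (y1 0 0)^-1 *: y2) *m A) 0 j)].
  rewrite -[X in is_true X]negbK; apply/negP => /existsPn nex.
  move/negP: aBad; apply; apply/bigcupP; exists (- (y1 0 0)^-1 *: y2) => //.
  apply/bigcupP; exists S'; first exact/eqP.
  rewrite /ball inE; apply/forallP => j; apply/implyP => jS.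
  by have := nex j; rewrite jS /= negbK.
case/andP=> jS' ne; exists j; first by apply: contra jS'; apply: (subsetP sS).
apply: contra ne; rewrite -scalemxAl scaleNr.
rewrite mxE [X in X + _]mxE addr_eq0 => /eqP e; rewrite mxE [X in - X]mxE.
by rewrite -[a 0 j](mulKf y10) e mulrN.
Qed.

(** * Resilient maps: partitions into orthogonal arrays of equal size *)

Definition agree (I A : finType) (S : {set I}) (v x : {ffun I -> A}) :=
  [forall i in S, x i == v i].

(* The fibres of G are orthogonal arrays of strength t, all of the same size. *)
Definition resilient (I A L : finType) (t : nat) (G : {ffun I -> A} -> L) :=
  forall (S : {set I}) (v v' : {ffun I -> A}) (l l' : L), (#|S| <= t)%N ->
    #|[set x | (G x == l) && agree S v x]| = #|[set x | (G x == l') && agree S v' x]|.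

(* Duality: if x |-> (A x, x restricted to S) were not onto, some nonzero
   combination of the rows of A would be supported in S. *)
Lemma linear_resilient (F : finFieldType) (n t r : nat) (A : 'M[F]_(r, n)) :
  (forall y : 'rV_r, y != 0 -> forall S : {set 'I_n}, (#|S| <= t)%N ->
     exists2 j, j \notin S & (y *m A) 0 j != 0) ->
  resilient t (fun x : {ffun 'I_n -> F} => (\row_j x j) *m A^T).
Proof.
move=> hA S v v' l l' St.
pose D : 'M[F]_n := diag_mx (\row_j (j \in S)%:R).
pose M := row_mx A^T D.
have surj (b : 'rV_r) (w : 'rV_n) : exists x : 'rV_n, x *m A^T = b /\ x *m D = w *m D.
  suff /submxP[x] : (row_mx b (w *m D) <= M)%MS.
    by rewrite mul_mx_row => /eq_row_mx[-> ->]; exists x.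
  (* The columns of [K] are linear forms cutting out the row space of [M]. The top block of each
     gives a combination of rows of [A] supported in [S], hence is zero; the bottom block is then
     killed by [D]. *)
  rewrite submxE; set K := cokermx M.
  have := mulmx_coker M; rewrite -/K -(vsubmxK K) !mul_row_col.
  set K1 := usubmx K; set K2 := dsubmx K => MK0.
  have K10 : K1 = 0.
    apply/trmx_inj/row_matrixP => j; rewrite trmx0 row0.
    apply/eqP; apply: contraT => y0.
    have [k kS] := hA _ y0 _ St; rewrite -row_mul -[A in _ *m A]trmxK -trmx_mul.
    have -> : A^T *m K1 = - (D *m K2) by apply/eqP; rewrite -addr_eq0 MK0.
    by rewrite mul_diag_mx !mxE (negbTE kS) mul0r oppr0 eqxx.
  move: MK0; rewrite K10 !mulmx0 !add0r => DK0.
  by rewrite -mulmxA DK0 mulmx0.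
(* Translation by [x0] carries one of the two sets onto the other. *)
have [x0 [x0A x0D]] := surj (l' - l) (\row_j (v' j - v j)).
have x0S j : j \in S -> x0 0 j = v' j - v j.
  move=> jS; have := congr1 (fun u : 'rV_n => u 0 j) x0D.
  by rewrite !mul_mx_diag !mxE jS !mulr1.
pose f (x : {ffun 'I_n -> F}) := [ffun j => x j + x0 0 j].
have finj : injective f.
  by move=> x y /ffunP e; apply/ffunP => j; have := e j; rewrite !ffunE => /addIr.
pose g (x : {ffun 'I_n -> F}) := [ffun j => x j - x0 0 j].
have fK : cancel g f by move=> x; apply/ffunP => j; rewrite !ffunE subrK.
rewrite -(card_imset _ finj); apply: eq_card => x.
rewrite -{1}[x]fK mem_imset // !inE; congr (_ && _).
  have -> : \row_j g x j = \row_j x j - x0 by apply/rowP => j; rewrite !mxE ffunE.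
  by rewrite mulmxBl x0A subr_eq addrC subrK.
apply: eq_forallb_in => j jS; rewrite ffunE x0S //.
by rewrite subr_eq addrC subrK.
Qed.

Lemma card_resilient_fiber (I A L : finType) t (G : {ffun I -> A} -> L) l :
  (0 < #|A|)%N -> resilient t G ->
  (#|[set x | G x == l]| * #|L| = #|A| ^ #|I|)%N.
Proof.
case/card_gt0P=> a0 _ hG; rewrite -card_ffun -[RHS]sum1_card.
rewrite (partition_big G predT) //=.
rewrite (eq_bigr (fun=> #|[set x | G x == l]|)) ?sum_nat_const ?cardT 1?mulnC //.
move=> l' _; have := hG set0 [ffun=> a0] [ffun=> a0] l l'; rewrite cards0 => /(_ isT).
have e l0 : [set x | (G x == l0) && agree set0 [ffun=> a0] x] = [set x | G x == l0].
  apply/setP => x; rewrite !inE; case: eqP => //= _.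
  by apply/forallP => i; rewrite inE.
by rewrite !e => ->; rewrite sum1dep_card.
Qed.

Lemma resilient_transport (I A B L M : finType) t (G : {ffun I -> A} -> L)
    (f : B -> A) (h : L -> M) : bijective f -> bijective h -> resilient t G ->
  resilient t (fun x : {ffun I -> B} => h (G [ffun i => f (x i)])).
Proof.
move=> [f' fK f'K] [h' hK h'K] hG S v v' l l' St.
pose phi (x : {ffun I -> B}) := [ffun i => f (x i)].
have phi_inj : injective phi.
  by move=> x y /ffunP e; apply/ffunP => i; have := e i; rewrite !ffunE => /(can_inj fK).
have key w k : #|[set x | (h (G (phi x)) == k) && agree S w x]|
   = #|[set x | (G x == h' k) && agree S (phi w) x]|.
  rewrite -(card_imset _ phi_inj); apply: eq_card => x.
  have {1}-> : x = phi [ffun i => f' (x i)] by apply/ffunP => i; rewrite !ffunE f'K.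
  rewrite mem_imset // !inE; congr (_ && _).
    rewrite -(can_eq hK) h'K; congr (h (G _) == _).
    by apply/ffunP => i; rewrite !ffunE f'K.
  by apply: eq_forallb => i; rewrite !ffunE -(can_eq fK) f'K.
by rewrite !key; apply: hG.
Qed.

Lemma card_ord_bij (A : finType) q : #|A| = q -> exists f : A -> 'I_q, bijective f.
Proof. by move=> <-; exists enum_rank; apply: enum_rank_bij. Qed.

Lemma resilient_ord (I A L : finType) t (G : {ffun I -> A} -> L) q l :
  #|A| = q -> #|L| = l -> resilient t G ->
  exists G' : {ffun I -> 'I_q} -> 'I_l, resilient t G'.
Proof.
move=> /card_ord_bij[f [f' fK f'K]] /card_ord_bij[h hbij] hG.
by eexists; apply: resilient_transport hbij hG; exists f; [exact: f'K | exact: fK].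
Qed.

Lemma resilient_prod (I A1 A2 L1 L2 : finType) t
    (G1 : {ffun I -> A1} -> L1) (G2 : {ffun I -> A2} -> L2) :
  resilient t G1 -> resilient t G2 ->
  resilient t (fun x : {ffun I -> A1 * A2} =>
                 (G1 [ffun i => (x i).1], G2 [ffun i => (x i).2])).
Proof.
move=> h1 h2 S v v' l l' St.
pose fs (x : {ffun I -> A1 * A2}) := [ffun i => (x i).1].
pose sn (x : {ffun I -> A1 * A2}) := [ffun i => (x i).2].
pose phi x := (fs x, sn x).
have phi_inj : injective phi.
  move=> x y [/ffunP e1 /ffunP e2]; apply/ffunP => i.
  have := e1 i; have := e2 i; rewrite !ffunE.
  by case: (x i) (y i) => [? ?] [? ?] /= -> ->.
have key w k : #|[set x | ((G1 (fs x), G2 (sn x)) == k) && agree S w x]|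
   = (#|[set x | (G1 x == k.1) && agree S (fs w) x]| *
      #|[set x | (G2 x == k.2) && agree S (sn w) x]|)%N.
  rewrite -cardsX -(card_imset _ phi_inj); apply: eq_card => -[x1 x2].
  have {1}-> : (x1, x2) = phi [ffun i => (x1 i, x2 i)].
    by congr (_, _); apply/ffunP => i; rewrite !ffunE.
  have e1 : fs [ffun i => (x1 i, x2 i)] = x1 by apply/ffunP => i; rewrite !ffunE.
  have e2 : sn [ffun i => (x1 i, x2 i)] = x2 by apply/ffunP => i; rewrite !ffunE.
  rewrite mem_imset // !inE e1 e2 -pair_eqE /= andbACA; congr (_ && _).
  apply/forall_inP/andP => [H|[/forall_inP H1 /forall_inP H2] i iS].
    by split; apply/forall_inP => i iS; have := H i iS; rewrite !ffunE => /eqP <-.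
  have := H1 i iS; have := H2 i iS; rewrite !ffunE => /eqP-> /eqP->.
  by rewrite -surjective_pairing.
by rewrite !key (h1 _ _ (fs v') _ l'.1) // (h2 _ _ (sn v') _ l'.2).
Qed.

(** The least prime factor [p] of [q] is split off: a code over F_p gives [p ^ r] labels, and the
    product with the map for [q %/ p] gives [q ^ r]. As [2 <= p], the bound in base 2 serves all
    primes. *)
Lemma exists_resilient (m t k r q : nat) : (t <= k)%N -> (0 < r)%N -> m = (k + r)%N ->
  ('C(m, t) <= 2 ^ (k - t))%N -> (0 < q)%N ->
  exists G : {ffun 'I_m -> 'I_q} -> 'I_(q ^ r), resilient t G.
Proof.
move=> tk r0 em hC; elim/ltn_ind: q => q IH q0.
have [q1|q1] := leqP q 1.
  have -> : q = 1%N by apply/eqP; rewrite eqn_leq q1.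
  rewrite exp1n; exists (fun=> ord0) => S v v' l l' _; apply: eq_card => x.
  rewrite !inE !ord1; congr (_ && _).
  by apply: eq_forallb_in => i _; rewrite [v i]ord1 [v' i]ord1.
have pp : prime (pdiv q) by apply: pdiv_prime.
set p := pdiv q in pp; have p1 := prime_gt1 pp.
have [A hA] : exists A : 'M['F_p]_(r, m), forall y : 'rV_r, y != 0 ->
    forall S : {set 'I_m}, (#|S| <= t)%N ->
    exists2 j, j \notin S & (y *m A) 0 j != 0.
  apply: gilbert_varshamov; first by rewrite em (leq_trans tk) ?leq_addr.
  rewrite card_Fp // -mulnA -expnD.
  (* The exponents add up to [k + r.-1], which is [m.-1] because [0 < r]. *)
  apply: (@leq_ltn_trans (p ^ (k - t) * p ^ (t + r.-1))).
    rewrite leq_mul2r (leq_trans hC) ?orbT //.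
    by case: (k - t)%N => // d; rewrite leq_exp2r.
  by rewrite -expnD ltn_exp2l // em; lia.
have [||G1 h1] := resilient_ord (q := p) (l := p ^ r) _ _ (linear_resilient hA).
- exact: card_Fp.
- by rewrite card_mx card_Fp // mul1n.
have eq : q = (p * (q %/ p))%N by rewrite mulnC divnK ?pdiv_dvd.
have [||G2 h2] := IH (q %/ p)%N; first by rewrite ltn_Pdiv.
  by rewrite divn_gt0 ?pdiv_leq // prime_gt0.
by apply: resilient_ord (resilient_prod h1 h2); rewrite card_prod !card_ord -?expnMn -eq.
Qed.

(* An orthogonal array of strength t with repeated words allowed. *)
Definition uniform_family (X I A : finType) (t : nat) (w : X -> {ffun I -> A}) :=
  forall (S : {set I}) (v v' : {ffun I -> A}), (#|S| <= t)%N ->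
    #|[set x | agree S v (w x)]| = #|[set x | agree S v' (w x)]|.

Lemma resilient_fiber_uniform (I A L : finType) t (G : {ffun I -> A} -> L) l :
  resilient t G ->
  uniform_family t (fun x : {x : {ffun I -> A} | G x == l} => val x).
Proof.
move=> hG S v v' St.
have key u : #|[set x : {x : {ffun I -> A} | G x == l} | agree S u (val x)]|
           = #|[set x | (G x == l) && agree S u x]|.
  rewrite -(card_imset _ val_inj); apply: eq_card => x; rewrite inE.
  apply/imsetP/andP => [[y + ->]|[Gx xS]]; first by rewrite inE (valP y).
  by exists (exist _ x Gx); rewrite ?inE.
by rewrite !key; apply: hG.
Qed.

(** * From the field to the alphabet: blanks and their filling *)

Lemma exists_injective (X Y : finType) :
  (#|X| <= #|Y|)%N -> exists f : X -> Y, injective f.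
Proof.
move=> le; exists (fun x => enum_val (widen_ord le (enum_rank x))).
by move=> x y /enum_val_inj /(congr1 val) /= e; apply/enum_rank_inj/val_inj.
Qed.

(** [q] disjoint blocks of [#|K| %/ q] points are embedded in [K], one block per symbol; the
    [#|K| %% q] remaining points become blanks. *)
Lemma exists_equitable_partial_map (K : finType) q : (0 < q)%N ->
  exists c : K -> option 'I_q,
    (forall a b, #|[set k | c k == Some a]| = #|[set k | c k == Some b]|) /\
    (#|[set k | c k == None]| < q)%N.
Proof.
move=> q0; set M := (#|K| %/ q)%N.
have [|f finj] := @exists_injective ('I_q * 'I_M)%type K.
  by rewrite card_prod !card_ord mulnC leq_trunc_div.
pose c k := [pick a | [exists b, f (a, b) == k]].
have cf a b : c (f (a, b)) = Some a.
  rewrite /c; case: pickP => [a' /existsP[b' /eqP/finj[->]] //|/(_ a)/negbT].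
  by rewrite negb_exists => /forallP/(_ b); rewrite eqxx.
have cS a : [set k | c k == Some a] = [set f (a, b) | b : 'I_M].
  apply/setP => k; rewrite inE; apply/eqP/imsetP => [|[b _ ->]]; last exact: cf.
  rewrite /c; case: pickP => // a' /existsP[b /eqP <-] [->].
  by exists b.
have cN : [set k | c k == None] = ~: [set f p | p in {: 'I_q * 'I_M}].
  apply/setP => k; rewrite !inE; apply/eqP/idP => [cn|].
    by apply: contra_eqN cn => /imsetP[[a b] _ ->]; rewrite cf.
  rewrite /c; case: pickP => // a /existsP[b /eqP <-] /negP[].
  by apply: imset_f.
exists c; split.
  have cM a : #|[set k | c k == Some a]| = M.
    by rewrite cS card_imset ?card_ord // => b b' /finj[].
  by move=> a b; rewrite !cM.
have := cardsC [set f p | p in {: 'I_q * 'I_M}].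
rewrite cN card_imset // card_prod !card_ord (divn_eq #|K| q) mulnC => /addnI ->.
by rewrite ltn_mod.
Qed.

(** Union bound over sets of [s] positions: words with at least [s] positions in [B] are fewer than
    the labels, so they miss some label. *)
Lemma exists_sparse_fiber (I K L : finType) (G : {ffun I -> K} -> L) (B : pred K) s :
  ('C(#|I|, s) * (#|B| ^ s * #|K| ^ (#|I| - s)) < #|L|)%N ->
  exists l, forall x, G x = l -> (#|[set i | B (x i)]| < s)%N.
Proof.
move=> hs.
pose Bad := \bigcup_(S : {set I} | #|S| == s) [set x : {ffun I -> K} | [forall i in S, B (x i)]].
have : (#|G @: Bad| < #|[set: L]|)%N.
  rewrite cardsT; apply: leq_ltn_trans hs; apply: leq_trans (leq_imset_card _ _) _.
  apply: leq_trans (leq_card_bigcup _ _) _.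
  rewrite -card_draws -sum_nat_const.
  rewrite [X in (_ <= X)%N](eq_bigl (fun S : {set I} => #|S| == s)).
    apply: leq_sum => S /eqP <-.
    pose C i : pred K := if i \in S then B else predT.
    rewrite -(prod_nat_if S) (eq_bigr (fun i => #|C i|)).
      rewrite -card_ffun_prod; apply/subset_leq_card/subsetP => x; rewrite !inE.
      move=> /forall_inP h; apply/forallP => i; rewrite /C.
      by case: ifP => // /h.
    by move=> i _; rewrite /C; case: ifP.
  by move=> S; rewrite inE.
move=> ltBad; have /subsetPn[l _ lBad] : ~~ ([set: L] \subset G @: Bad).
  by apply: contraL ltBad => /subset_leq_card; rewrite leqNgt.
exists l => x Gx; rewrite ltnNge; apply: contra lBad => sB.
have : (0 < #|[set S : {set I} | S \subset [set i | B (x i)] & #|S| == s]|)%N.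
  by rewrite cards_draws bin_gt0.
case/card_gt0P=> S; rewrite inE => /andP[SB sS].
rewrite -Gx; apply: imset_f; apply/bigcupP; exists S => //.
by rewrite inE; apply/forall_inP => i /(subsetP SB); rewrite inE.
Qed.

(** Each restriction to [S] occurs for equally many [x], and the sum over all restrictions factors
    by distributivity. *)
Lemma uniform_family_sum_prod (X I K : finType) t (w : X -> {ffun I -> K})
    (S : {set I}) (v : {ffun I -> K}) (phi : I -> K -> nat) :
  uniform_family t w -> (#|S| <= t)%N ->
  (\sum_x \prod_(i in S) phi i (w x i) =
   #|[set x | agree S v (w x)]| * \prod_(i in S) \sum_k phi i k)%N.
Proof.
move=> hw St; have [X0|/card_gt0P[x0 _]] := posnP #|X|.
  rewrite big1 => [|x]; last by have := card0_eq X0 x; rewrite !inE.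
  by rewrite (_ : #|_| = 0%N) //; apply/eqP; rewrite -leqn0 -X0 max_card.
have [I0|/card_gt0P[i0 _]] := posnP #|I|.
  have S0 : S = set0 by apply/setP => i; have := card0_eq I0 i; rewrite !inE.
  rewrite S0 big_set0 muln1 (eq_bigr (fun=> 1%N)) => [|x _]; last by rewrite big_set0.
  rewrite sum1_card; apply: eq_card => x; rewrite !inE; apply/esym/forall_inP => i.
  by rewrite inE.
pose k0 := w x0 i0.
rewrite (big_distr_big_dep k0) /=.
(* Padding by [k0] off [S] matches the functions indexing the distributed product. *)
pose res x := [ffun i => if i \in S then w x i else k0].
rewrite (partition_big res (mem (pfamily k0 (mem S) (fun=> predT)))) /=; last first.
  move=> x _; apply/pfamilyP; split=> // ; apply/supportP => i iS.
  by rewrite ffunE (negbTE iS).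
rewrite big_distrr /=; apply: eq_bigr => a /pfamilyP[/supportP aS _].
rewrite (hw S v a St) -sum1dep_card big_distrl /=.
apply: eq_big => x.
  apply/eqP/forall_inP => [<- i iS|H]; first by rewrite ffunE iS.
  apply/ffunP => i; rewrite ffunE; case: ifP => [/H/eqP //|/negbT /aS //].
by move/eqP <-; rewrite mul1n; apply: eq_bigr => i iS; rewrite ffunE iS.
Qed.

(* Blanks are filled by entries of a uniform z, distinct blanks of one word using
   distinct entries.  Given x, the word matches v on S for
   q^(s - #blanks in S) values of z if it matches v on the other positions of S;
   this is q^(s - #|S|) times a product over S, so that only the restriction of
   the word to S matters. *)
Lemma uniform_family_fill (X I K : finType) t s q (w : X -> {ffun I -> K})
    (c : K -> option 'I_q) :
  uniform_family t w -> (0 < s)%N -> (t <= s)%N ->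
  (forall x, #|[set i | c (w x i) == None]| <= s)%N ->
  (forall a b, #|[set k | c k == Some a]| = #|[set k | c k == Some b]|) ->
  exists w' : X * {ffun 'I_s -> 'I_q} -> {ffun I -> 'I_q}, uniform_family t w'.
Proof.
move=> hw s0 ts hb hc.
pose B x := [set i | c (w x i) == None].
(* The blanks of the [x]-th word are numbered; there are at most [s], so the default is never called
   on at a blank. *)
pose rho x i : 'I_s := insubd (Ordinal s0) (index i (enum (B x))).
have rho_inj x : {in B x &, injective (rho x)}.
  have valE i : i \in B x -> val (rho x i) = index i (enum (B x)).
    move=> iB; rewrite val_insubd (leq_trans _ (hb x)) //.
    by rewrite cardE index_mem mem_enum.
  move=> i j iB jB /(congr1 val); rewrite !valE //.
  by move/(congr1 (nth i (enum (B x)))); rewrite !nth_index ?mem_enum.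
exists (fun p : X * {ffun 'I_s -> 'I_q} =>
  [ffun i => odflt (p.2 (rho p.1 i)) (c (w p.1 i))]) => S v v' St.
(* A correct symbol weighs [q], a wrong one 0, a blank 1. For a word correct off its blanks, the
   product times [q ^ (s - #|S|)] is [q] to the power [s] minus the number of blanks in [S]. *)
pose phi (u : {ffun I -> 'I_q}) i k :=
  if c k is Some a then if a == u i then q else 0%N else 1%N.
have key u : #|[set p : X * {ffun 'I_s -> 'I_q} |
      agree S u [ffun i => odflt (p.2 (rho p.1 i)) (c (w p.1 i))]]|
    = (q ^ (s - #|S|) * \sum_x \prod_(i in S) phi u i (w x i))%N.
  rewrite -sum1dep_card big_mkcond /= -(pair_bigA _ (fun x (z : {ffun 'I_s -> 'I_q}) =>
    if agree S u [ffun i => odflt (z (rho x i)) (c (w x i))] then 1%N else 0%N)) /=.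
  rewrite big_distrr /=; apply: eq_bigr => x _; rewrite -big_mkcond sum1dep_card.
  have [/forall_inP H|/forall_inPn[i iS]] := boolP [forall i in S, phi u i (w x i) != 0%N].
    rewrite (eq_bigr (fun i => if i \in B x then 1%N else q)) => [|i iS]; last first.
      have := H i iS; rewrite /phi inE; case: (c (w x i)) => // a.
      by case: ifP.
    (* Entries of [z] in [T] are forced by the blanks in [S]; the others have [q] choices each. *)
    pose T := [set rho x i | i in S :&: B x].
    pose C j : pred 'I_q := fun a => [forall i in S :&: B x, (rho x i == j) ==> (a == u i)].
    have CE j : #|C j| = if j \in T then 1%N else q.
      case: ifP => [/imsetP[i iSB ->]|jT].
        rewrite -(card1 (u i)); apply: eq_card => a; rewrite !inE /C.
        apply/forall_inP/eqP => [/(_ i iSB)|-> i' i'SB]; first by rewrite eqxx => /eqP.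
        apply/implyP => /eqP/rho_inj-> //; first by move: i'SB; rewrite inE => /andP[].
        by move: iSB; rewrite inE => /andP[].
      rewrite -[RHS](card_ord q); apply: eq_card => a; rewrite !inE /C.
      apply/forall_inP => i iSB; apply/implyP => /eqP e.
      by move: jT; rewrite -e imset_f.
    have -> : [set z : {ffun 'I_s -> 'I_q} |
        agree S u [ffun i => odflt (z (rho x i)) (c (w x i))]]
        = [set z : {ffun 'I_s -> 'I_q} | [forall j, C j (z j)]].
      apply/setP => z; rewrite !inE; apply/forall_inP/forallP => [Hz j|Hz i iS].
        apply/forall_inP => i; rewrite !inE => /andP[iS /eqP ciN]; apply/implyP => /eqP <-.
        by have := Hz i iS; rewrite ffunE ciN.
      rewrite ffunE; have := H i iS; rewrite /phi.
      case E : (c (w x i)) => [a|] /=; first by case: ifP.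
      move=> _; have /forall_inP/(_ i) := Hz (rho x i).
      by rewrite !inE iS E eqxx; apply.
    rewrite card_ffun_prod (eq_bigr _ (fun j _ => CE j)) prod_nat_if exp1n mul1n card_ord.
    rewrite (bigID (mem (B x))) /= big1 => [|i /andP[_ ->] //].
    rewrite mul1n (eq_bigr (fun=> q)) => [|i /andP[_ /negbTE->] //].
    rewrite (eq_bigl (mem (S :\: B x))) => [|i]; last by rewrite !inE andbC.
    rewrite prod_nat_const -expnD card_in_imset => [|i j]; last first.
      by rewrite !in_setI => /andP[_ iB] /andP[_ jB]; apply: rho_inj.
    congr (q ^ _)%N; have := cardsID (B x) S; lia.
  rewrite negbK => /eqP phi0; rewrite (bigD1 i) //= phi0 mul0n muln0.
  apply/eqP; rewrite cards_eq0 -subset0; apply/subsetP => z; rewrite !inE => /forall_inP.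
  move=> /(_ i iS); rewrite ffunE; move: phi0; rewrite /phi.
  (* A matching symbol of weight 0 would give [q = 0], while [u i] inhabits ['I_q]. *)
  by case: (c (w x i)) => //= a; case: eqP => // _ q0; case: (u i) => ? /=; rewrite q0.
rewrite !key; congr (_ * _)%N.
have [I0|/card_gt0P[i0 _]] := posnP #|I|.
  have S0 : S = set0 by apply/setP => i; have := card0_eq I0 i; rewrite !inE.
  by rewrite S0; apply: eq_bigr => x _; rewrite !big_set0.
have [X0|/card_gt0P[x0 _]] := posnP #|X|.
  by rewrite !big1 // => x; have := card0_eq X0 x; rewrite !inE.
rewrite !(uniform_family_sum_prod (w x0) _ hw St); congr (_ * _)%N.
apply: eq_bigr => i iS.
(* Only the size of the class of [u i] enters, and [hc] makes all classes equal. *)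
have sumE u : (\sum_k phi u i k = #|[set k | c k == Some (u i)]| * q + #|[set k | c k == None]|)%N.
  rewrite (bigID (fun k => c k == None)) /= addnC; congr (_ + _)%N.
    rewrite (bigID (fun k => c k == Some (u i))) /= [X in (_ + X)%N]big1 ?addn0.
      rewrite -sum_nat_const; apply: eq_big => k; first by rewrite inE; case: (c k).
      by case/andP=> _ /eqP ck; rewrite /phi ck eqxx.
    move=> k /andP[]; rewrite /phi; case: (c k) => // a _.
    by case: (a =P u i) => // ->; rewrite eqxx.
  by rewrite -sum1dep_card; apply: eq_bigr => k /eqP ck; rewrite /phi ck.
by rewrite !sumE (hc _ (v' i)).
Qed.

(** * Removing repetitions, and return to orthogonal arrays *)

Definition uniform_set (I A : finType) (t : nat) (T : {set {ffun I -> A}}) :=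
  forall (S : {set I}) (v v' : {ffun I -> A}), (#|S| <= t)%N ->
    #|[set x in T | agree S v x]| = #|[set x in T | agree S v' x]|.

(* Appending to the x-th word all the words of a fibre of G that depends
   injectively on x makes all words distinct. *)
Lemma uniform_family_tag (X I1 I2 A L : finType) t
    (w : X -> {ffun I1 -> A}) (G : {ffun I2 -> A} -> L) :
  uniform_family t w -> resilient t G -> (#|X| <= #|L|)%N -> (0 < #|A|)%N ->
  exists2 T : {set {ffun I1 + I2 -> A}}, uniform_set t T &
    (#|T| * #|L| = #|X| * #|A| ^ #|I2|)%N.
Proof.
move=> hw hG XL A0.
have [sg sg_inj] := exists_injective XL.
pose join (p : X * {ffun I2 -> A}) : {ffun I1 + I2 -> A} :=
  [ffun i => match i with inl j => w p.1 j | inr j => p.2 j end].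
pose P := [set p : X * {ffun I2 -> A} | G p.2 == sg p.1].
have join_inj : {in P &, injective join}.
  move=> [x y] [x' y']; rewrite !inE /= => /eqP Gy /eqP Gy' /ffunP e.
  have eyy : y = y' by apply/ffunP => i; have := e (inr i); rewrite !ffunE.
  by congr (_, _) => //; apply: sg_inj; rewrite -Gy eyy.
pose fs (v : {ffun I1 + I2 -> A}) : {ffun I1 -> A} := [ffun i => v (inl i)].
pose sn (v : {ffun I1 + I2 -> A}) : {ffun I2 -> A} := [ffun i => v (inr i)].
have S1t (S : {set I1 + I2}) : (#|S| <= t)%N -> (#|inl @^-1: S : {set I1}| <= t)%N.
  apply: leq_trans; rewrite -(card_imset _ (@inl_inj I1 I2)).
  by apply/subset_leq_card/subsetP => _ /imsetP[i + ->]; rewrite inE.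
have S2t (S : {set I1 + I2}) : (#|S| <= t)%N -> (#|inr @^-1: S : {set I2}| <= t)%N.
  apply: leq_trans; rewrite -(card_imset _ (@inr_inj I1 I2)).
  by apply/subset_leq_card/subsetP => _ /imsetP[i + ->]; rewrite inE.
(* The tail of the [x]-th word runs over the fibre at [sg x]; by resilience its count is that for a
   fixed [l0], so the total count factors. *)
have key (S : {set I1 + I2}) v l0 : (#|S| <= t)%N -> #|[set u in join @: P | agree S v u]|
   = (#|[set x | agree (inl @^-1: S) (fs v) (w x)]| *
      #|[set y | (G y == l0) && agree (inr @^-1: S) (sn v) y]|)%N.
  move=> St.
  have -> : [set u in join @: P | agree S v u] = join @: [set p in P | agree S v (join p)].
    apply/setP => u; rewrite inE; apply/andP/imsetP => [[/imsetP[p pP ->] pS]|[p]].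
      by exists p; rewrite // inE pP.
    by rewrite inE => /andP[pP pS] ->; rewrite imset_f.
  rewrite card_in_imset => [|p p']; last first.
    by rewrite !in_set => /andP[pP _] /andP[pP' _]; apply: join_inj; rewrite !inE.
  have joinE x y : agree S v (join (x, y)) =
      agree (inl @^-1: S) (fs v) (w x) && agree (inr @^-1: S) (sn v) y.
    apply/forall_inP/andP => [H|[/forall_inP H1 /forall_inP H2] [i|i] iS].
    - by split; apply/forall_inP => i; rewrite inE => /H; rewrite !ffunE.
    - by have := H1 i; rewrite !ffunE inE; apply.
    - by have := H2 i; rewrite !ffunE inE; apply.
  rewrite -sum1dep_card -[in RHS]sum1dep_card big_distrl /= big_mkcond.
  pose F x y := if ((x, y) \in P) && agree S v (join (x, y)) then 1%N else 0%N.
  rewrite (eq_bigr (fun p => F p.1 p.2)) => [|[x y] _ //]; rewrite -(pair_bigA _ F) /=.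
  rewrite [RHS]big_mkcond; apply: eq_bigr => x _ /=.
  rewrite -big_mkcond sum1dep_card mul1n; case: ifPn => xS.
    rewrite (hG _ (sn v) (sn v) l0 (sg x)) ?S2t //; apply: eq_card => y.
    by rewrite !inE joinE xS.
  apply/eqP; rewrite cards_eq0 -subset0; apply/subsetP => y.
  by rewrite !inE joinE (negbTE xS) andbF.
exists (join @: P).
  move=> S v v' St; have [X0|/card_gt0P[x0 _]] := posnP #|X|.
    have P0 : P = set0 by apply/setP => -[x y]; have := card0_eq X0 x; rewrite !inE.
    by rewrite P0 imset0; congr #|pred_of_set _|; apply/setP => u; rewrite !inE.
  rewrite !(key _ _ (sg x0)) // (hw _ _ (fs v')) ?S1t //.
  by rewrite (hG _ (sn v) (sn v') (sg x0) (sg x0)) ?S2t.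
rewrite card_in_imset // -sum1dep_card big_mkcond /=.
rewrite -(pair_bigA _ (fun x y => if G y == sg x then 1%N else 0%N)) /=.
rewrite (eq_bigr (fun x => #|[set y | G y == sg x]|)) => [|x _]; last first.
  by rewrite -big_mkcond sum1dep_card.
rewrite big_distrl /= (eq_bigr (fun=> (#|A| ^ #|I2|)%N)) ?sum_nat_const // => x _.
exact: card_resilient_fiber hG.
Qed.

(** The [q ^ t] prescriptions at [t] distinct positions cut [T] into classes of equal size. *)
Lemma uniform_set_orthogonal_array (I : finType) (q n t : nat)
    (T : {set {ffun I -> 'I_q}}) : #|I| = n -> uniform_set t T -> (0 < q)%N ->
  exists2 T' : {set {ffun 'I_n -> 'I_q}}, orthogonal_array t T' & #|T'| = #|T|.
Proof.
move=> /card_ord_bij[e [e' eK e'K]] hT q0.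
pose psi (x : {ffun I -> 'I_q}) := [ffun i => x (e' i)].
have psi_inj : injective psi.
  by move=> x y /ffunP h; apply/ffunP => i; have := h (e i); rewrite !ffunE eK.
exists (psi @: T); last exact: card_imset.
move=> i v i_inj; rewrite card_imset //.
pose N (u : {ffun 'I_t -> 'I_q}) := #|[set x in T | [forall j, x (e' (i j)) == u j]]|.
pose S := [set e' (i j) | j : 'I_t].
have St : (#|S| <= t)%N by rewrite (leq_trans (leq_imset_card _ _)) ?card_ord.
have j_inj : injective (fun j => e' (i j)) by move=> j k /(can_inj e'K)/i_inj.
have NE u : exists x, N u = #|[set y in T | agree S x y]|.
  (* Off the [t] prescribed positions the value is arbitrary. *)
  exists [ffun k => odflt (Ordinal q0) (omap u [pick j | e' (i j) == k])].
  apply: eq_card => x; rewrite !inE; congr (_ && _); apply/forallP/forall_inP.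
    move=> H _ /imsetP[j _ ->]; rewrite ffunE; case: pickP => [k /eqP/j_inj ->|/(_ j)] /=.
      exact: H.
    by rewrite eqxx.
  move=> H j; have /H : e' (i j) \in S by apply: imset_f.
  by rewrite ffunE; case: pickP => [k /eqP/j_inj ->|/(_ j)] //=; rewrite eqxx.
have NC u u' : N u = N u' by have [x ->] := NE u; have [x' ->] := NE u'; apply: hT.
have -> : #|[set x in psi @: T | [forall j, x (i j) == v j]]| = N [ffun j => v j].
  rewrite -[RHS](card_imset _ psi_inj); apply: eq_card => x; rewrite inE.
  apply/andP/imsetP => [[/imsetP[y yT ->] /forallP H]|[y]].
    exists y => //; rewrite inE yT; apply/forallP => j.
    by have := H j; rewrite !ffunE.
  rewrite inE => /andP[yT /forallP H] ->; split; first exact: imset_f.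
  by apply/forallP => j; have := H j; rewrite !ffunE.
have -> : #|T| = (q ^ t * N [ffun j => v j])%N.
  pose sub (x : {ffun I -> 'I_q}) := [ffun j => x (e' (i j))].
  rewrite -sum1_card (partition_big sub predT) //=.
  rewrite -[q in (q ^ _)%N]card_ord -[t in (_ ^ t)%N]card_ord -card_ffun -sum_nat_const.
  apply: eq_bigr => u _; rewrite (NC _ u) sum1dep_card; apply: eq_card => x.
  rewrite !inE; congr (_ && _); apply/eqP/forallP => [<- j|H]; first by rewrite ffunE.
  by apply/ffunP => j; rewrite ffunE; apply/eqP.
by rewrite natrM natrX mulKf // expf_neq0 // pnatr_eq0 -lt0n.
Qed.

Lemma uniform_set_setT (I A : finType) (t : nat) : uniform_set t [set: {ffun I -> A}].
Proof.
have key (S : {set I}) (v : {ffun I -> A}) :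
    #|[set x in [set: {ffun I -> A}] | agree S v x]| = (#|A| ^ (#|I| - #|S|))%N.
  rewrite -[RHS]mul1n -[X in (X * _)%N](exp1n #|S|) -prod_nat_if.
  pose B i : pred A := if i \in S then pred1 (v i) else predT.
  rewrite (eq_bigr (fun i => #|B i|)) => [|i _]; last first.
    by rewrite /B; case: ifP; rewrite ?card1.
  rewrite -card_ffun_prod; apply: eq_card => x; rewrite !inE.
  apply/forall_inP/forallP => H i; have := H i; rewrite /B; case: ifP => // iS; first exact.
by move=> S v v' _; rewrite !key.
Qed.

(** * Binomial estimates *)

Lemma bin_leq_exp2 n k : ('C(n, k) <= 2 ^ n)%N.
Proof.
have [kn|nk] := leqP k n; last by rewrite bin_small.
rewrite -[2%N]/(1 + 1)%N expnDn (bigD1 (Ordinal (kn : k < n.+1)%N)) //=.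
by rewrite !exp1n !muln1 leq_addr.
Qed.

(** The middle term [(2 * s) ^_ s] has all factors at least [s], and is a central binomial
    coefficient times the factorial of [s]. *)
Lemma expnn_leq_fact s : (s ^ s <= 4 ^ s * s`!)%N.
Proof.
apply: (@leq_trans ((2 * s) ^_ s)).
  rewrite ffact_prod -[X in (_ ^ X)%N]card_ord -prod_nat_const.
  by apply: leq_prod => i _; have := ltn_ord i; lia.
by rewrite -bin_ffact leq_mul2r (leq_trans (bin_leq_exp2 _ _)) ?orbT // expnM.
Qed.

Lemma bin_leq_expn n s D : (n <= D * s)%N -> ('C(n, s) <= (4 * D) ^ s)%N.
Proof.
move=> nD; rewrite -(leq_pmul2r (fact_gt0 s)) bin_ffact.
apply: (@leq_trans (n ^ s)).
  rewrite ffact_prod -[X in (_ <= _ ^ X)%N]card_ord -prod_nat_const.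
  by apply: leq_prod => i _; apply: leq_subr.
apply: (@leq_trans ((D * s) ^ s)).
  by case: s {nD} (nD) => // s ?; rewrite leq_exp2r.
rewrite !expnMn [(4 ^ s * _)%N]mulnC -mulnA leq_mul2l.
by rewrite expnn_leq_fact orbT.
Qed.

Lemma leq_expn2r a b s : (a <= b -> a ^ s <= b ^ s)%N.
Proof. by case: s => // s; rewrite leq_exp2r. Qed.

(** * Choice of parameters and assembly *)

(** Over a field of [P = 2 ^ (4 * l)] elements, a linear map with [n - 2 * t] outputs has fibres of
    size [P ^ (2 * t)]; filling with [4 * t] uniform entries contributes [q ^ (4 * t)]. *)
Lemma exists_uniform_family (n t q l : nat) : (2 <= q)%N -> (0 < t)%N ->
  (2 * t < n)%N -> (q * (n %/ t) < 2 ^ l)%N ->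
  exists X : finType, exists2 w : X -> {ffun 'I_n -> 'I_q}, uniform_family t w &
    #|X| = ((2 ^ (4 * l)) ^ (2 * t) * q ^ (4 * t))%N.
Proof.
move=> q2 t0 tn ql.
set d := (n %/ t)%N in ql; set P := (2 ^ (4 * l))%N.
have d0 : (0 < d)%N by rewrite divn_gt0 //; lia.
have nd : (n < d.+1 * t)%N by rewrite ltn_ceil.
have l2 : (2 <= l)%N.
  have : (2 ^ 1 < 2 ^ l)%N by apply: leq_ltn_trans ql; rewrite expn1; nia.
  by rewrite ltn_exp2l.
have d_l : (d <= 2 ^ l)%N by apply: leq_trans (ltnW ql); nia.
have [|K _ cK] := @pPrimePowerField 2 (4 * l) isT; first by lia.
have P1 : (1 < P)%N by rewrite -{1}(expn0 2) ltn_exp2l //; lia.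
(* As [n <= 2 * d * t], the binomial is at most [(8 * d) ^ t], and [8 * d <= 2 ^ (l + 3) <= P]. *)
have Pt : ('C(n, t) <= P ^ t)%N.
  apply: leq_trans (@bin_leq_expn n t (2 * d) _) _; first by nia.
  apply: leq_expn2r; apply: (@leq_trans (2 ^ 3 * 2 ^ l)); first by rewrite mulnA leq_mul.
  by rewrite -expnD leq_exp2l //; lia.
have [A hA] : exists A : 'M[K]_(n - 2 * t, n), forall y : 'rV_(n - 2 * t), y != 0 ->
    forall S : {set 'I_n}, (#|S| <= t)%N ->
    exists2 j, j \notin S & (y *m A) 0 j != 0.
  apply: gilbert_varshamov; first by lia.
  rewrite cK -/P; apply: (@leq_ltn_trans (P ^ t * P ^ t * P ^ (n - 2 * t).-1)).
    by rewrite !leq_mul2r Pt !orbT.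
  by rewrite -!expnD ltn_exp2l //; lia.
have hG := linear_resilient hA; set G := (fun x => _) in hG.
have [|c [hc cN]] := @exists_equitable_partial_map K q; first by lia.
(* After cancelling [P ^ (n - 4 * t)], the bound reads [(4 * d * q) ^ (4 * t) < P ^ (2 * t)]; it
   follows from [q * d < 2 ^ l] and [l + 2 <= 2 * l], hence the need for [l2]. *)
have [|x0 hx0] := @exists_sparse_fiber _ _ _ G (fun k => c k == None) (4 * t).
  rewrite card_ord card_mx cK -/P mul1n.
  have [nt|tn4] := ltnP n (4 * t); first by rewrite bin_small // expn_gt0 (ltnW P1).
  have -> : (n - 2 * t = 2 * t + (n - 4 * t))%N by lia.
  rewrite mulnA expnD ltn_pmul2r ?expn_gt0 ?(ltnW P1) //.
  apply: (@leq_ltn_trans ((4 * d) ^ (4 * t) * q ^ (4 * t))).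
    apply: leq_mul; first by apply: bin_leq_expn; nia.
    by apply: leq_expn2r; rewrite -cardsE ltnW.
  rewrite -expnMn; apply: (@leq_trans ((2 ^ (l + 2)) ^ (4 * t))).
    by rewrite ltn_exp2r ?muln_gt0 // expnD; nia.
  by rewrite -!expnM leq_exp2l //; nia.
have [|||w hw] := uniform_family_fill (s := 4 * t) (resilient_fiber_uniform x0 hG) _ _ _ hc.
- by lia.
- by lia.
- by move=> x; apply/ltnW/hx0/eqP/(valP x).
exists ({x | G x == x0} * {ffun 'I_(4 * t) -> 'I_q})%type; exists w => //.
rewrite card_prod card_ffun !card_ord; congr (_ * _)%N.
have K0 : (0 < #|K|)%N by rewrite cK expn_gt0.
have Pn : (P ^ n = P ^ (2 * t) * P ^ (n - 2 * t))%N by rewrite -expnD; congr expn; lia.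
have := card_resilient_fiber x0 K0 hG; rewrite card_mx card_ord cK -/P mul1n Pn => /eqP.
by rewrite eqn_pmul2r ?expn_gt0 ?(ltnW P1) // card_sig cardsE => /eqP.
Qed.

Lemma exists_small_orthogonal_array (n t q l : nat) : (2 <= q)%N -> (0 < t <= n)%N ->
  (q * (n %/ t) < 2 ^ l)%N ->
  exists T : {set {ffun 'I_n -> 'I_q}},
    [/\ T != set0, orthogonal_array t T & (#|T| <= 2 ^ (104 * l * t))%N].
Proof.
move=> q2 /andP[t0 tn] ql; have q0 := ltnW q2.
(* [b] stands for the ratio of [l] to log q: [q ^ b] lies between [2 ^ l] and [2 ^ (4 * l)]. *)
set a := trunc_log 2 q; set b := (l %/ a).+1.
have [qa_le qa_lt] : (2 ^ a <= q)%N /\ (q < 2 ^ a.+1)%N by apply/andP; apply: trunc_log_bounds.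
have a0 : (0 < a)%N by rewrite trunc_log_gt0.
have al : (a <= l)%N.
  rewrite -(leq_exp2l _ _ (isT : 1 < 2)%N); apply: leq_trans (ltnW ql).
  by rewrite (leq_trans qa_le) // leq_pmulr // divn_gt0.
have [lab abl] : (l <= a * b /\ a * b <= 2 * l)%N.
  split; first by rewrite mulnC ltnW // ltn_ceil.
  by rewrite mulnS mulnC; have := leq_trunc_div l a; lia.
have q_le e : (q ^ (b * e) <= 2 ^ (4 * l * e))%N.
  apply: (@leq_trans ((2 ^ a.+1) ^ (b * e))); first by apply/leq_expn2r/ltnW.
  by rewrite -expnM leq_exp2l //; nia.
(* In the small case the whole cube has at most [q ^ (26 * b * t)] words; 104 is [4 * 26]. In the
   large case [24 * b * t] coordinates serve as tags and more than [2 * b * t] remain. *)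
have [small|large] := leqP n (26 * b * t).
  have [|T hT cT] := uniform_set_orthogonal_array (card_ord n) (@uniform_set_setT 'I_n 'I_q t).
    by [].
  move: cT; rewrite cardsT card_ffun !card_ord => cT.
  exists T; split=> //; first by rewrite -card_gt0 cT expn_gt0 q0.
  rewrite cT; apply: (@leq_trans (q ^ (b * (26 * t)))).
    by rewrite leq_exp2l //; lia.
  by apply: leq_trans (q_le _) _; rewrite leq_exp2l //; lia.
(* [r] makes [q ^ r] at least [2 ^ (12 * l * t)], the bound on [#|X|]; [m] is [2 * r], so that each
   tag fibre has [q ^ r] words. *)
pose m := (24 * b * t)%N; pose r := (12 * b * t)%N; pose n1 := (n - m)%N.
have b2 : (2 <= b)%N by rewrite /b ltnS divn_gt0.
have [G hG] : exists G : {ffun 'I_m -> 'I_q} -> 'I_(q ^ r), resilient t G.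
  apply: (@exists_resilient m t r r); rewrite /m /r //; first by nia.
  - by rewrite !muln_gt0 t0.
  - by lia.
  (* [96 * b <= 2 ^ (7 + b)], and [7 + b <= 12 * b - 1]. *)
  apply: (@leq_trans ((4 * (24 * b)) ^ t)); first exact: bin_leq_expn.
  have -> : (12 * b * t - t = (12 * b - 1) * t)%N by rewrite mulnBl mul1n.
  rewrite expnM; apply: leq_expn2r; rewrite mulnA.
  apply: (@leq_trans (2 ^ 7 * 2 ^ b)); first by rewrite leq_mul // ltnW // ltn_expl.
  by rewrite -expnD leq_exp2l //; lia.
have [||X [w hw cX]] := @exists_uniform_family n1 t q l q2 t0.
- by rewrite /n1 /m; nia.
- by apply: leq_ltn_trans ql; rewrite leq_mul2l leq_div2r ?orbT // leq_subr.
have cXle : (#|X| <= 2 ^ (12 * l * t))%N.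
  rewrite cX; apply: (@leq_trans ((2 ^ (4 * l)) ^ (2 * t) * (2 ^ l) ^ (4 * t))).
    rewrite leq_mul2l leq_expn2r ?orbT // ltnW // (leq_ltn_trans _ ql) //.
    by rewrite leq_pmulr // divn_gt0.
  by rewrite -!expnM -expnD leq_exp2l //; lia.
have [||T hT cT] := uniform_family_tag hw hG.
- rewrite card_ord (leq_trans cXle) // (@leq_trans ((2 ^ a) ^ r)) ?leq_expn2r //.
  by rewrite -expnM leq_exp2l // /r; nia.
- by rewrite card_ord.
have {}cT : #|T| = (#|X| * q ^ r)%N.
  have qm : (q ^ m = q ^ r * q ^ r)%N by rewrite -expnD /m /r; congr expn; lia.
  by move: cT; rewrite !card_ord qm mulnA => /eqP; rewrite eqn_pmul2r ?expn_gt0 ?q0 // => /eqP.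
have [||T' hT' cT'] := uniform_set_orthogonal_array (n := n) _ hT _ => //.
  by rewrite card_sum !card_ord /n1 subnK // /m; nia.
exists T'; rewrite cT' cT; split=> //.
  by rewrite -card_gt0 cT' cT cX !muln_gt0 !expn_gt0 q0.
(* The exponents of 2 are [12 * l * t] for [X] and [48 * l * t] for [q ^ r], within the allowed
   [104 * l * t]. *)
have r_eq : r = (b * (12 * t))%N by rewrite /r; lia.
apply: leq_trans (leq_mul cXle _) _; first by rewrite r_eq; apply: q_le.
by rewrite -expnD leq_exp2l //; lia.
Qed.

Theorem theorem1p1 (R : realType) :
  exists c : R, 0 < c /\
    forall q n t : nat, (2 <= q)%N -> (1 <= n)%N -> (1 <= t <= n)%N ->
      exists T : {set {ffun 'I_n -> 'I_q}},
        [/\ T != set0,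
            orthogonal_array t T &
            #|T|%:R <= (c * q%:R * n%:R / t%:R) `^ (c * t%:R)].
Proof.
(* With [l] one more than the integer logarithm of [q * d], [2 ^ l <= 2 * (q * d)]; the base 104
   absorbs the 2, and [d] is at most n/t. *)
exists 104%:R; split=> // q n t q2 _ tn; have [t0 le_tn] := andP tn.
set d := (n %/ t)%N; set l := (trunc_log 2 (q * d)).+1.
have d0 : (0 < d)%N by rewrite divn_gt0.
have [ql_le ql_lt] : (2 ^ l.-1 <= q * d)%N /\ (q * d < 2 ^ l)%N.
  by apply/andP/trunc_log_bounds; rewrite // muln_gt0 d0 (ltnW q2).
have [T [T0 hT cT]] := exists_small_orthogonal_array q2 tn ql_lt.
(* The exponent is a natural number, so the real power is an ordinary one. *)
exists T; split=> //; rewrite -[104%:R * t%:R]natrM powR_mulrn ?divr_ge0 ?mulr_ge0 ?ler0n //.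
have : (#|T| <= (2 * (q * d)) ^ (104 * t))%N.
  apply: leq_trans cT _; rewrite mulnAC mulnC expnM leq_expn2r //.
  by rewrite /l expnS leq_mul2l; apply: ql_le.
rewrite -(ler_nat R) => /le_trans; apply; rewrite natrX lerXn2r ?nnegrE //.
  by rewrite divr_ge0 ?mulr_ge0 ?ler0n.
rewrite ler_pdivlMr ?ltr0n // -!natrM ler_nat.
have := leq_trunc_div n t; rewrite -/d; nia.
Qed.
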